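(* Martin-Löf type theory MLTT extended with the law of excluded middle $\mathbf{LEM}$ is impredicative, in the sense that classical second-order arithmetic $\mathbf{PA}^2$ can be interpreted in it.
   Context: MLTT is intensional Martin-Löf type theory with the empty type $N_0$, unit type, natural numbers, disjoint sums $+$, $\Pi$-types, $\Sigma$-types, identity types and universes $U_0,U_1,\dots$; propositions are identified with types. $\mathbf{LEM}$ for MLTT postulates, for every type $A$, a proof-term of the type $A+(A\to N_0)$. $\mathbf{PA}^2$ is classical second-order arithmetic: the language of $\mathbf{PA}$ with a second sort of variables $X,Y,\dots$ for sets of natural numbers and atomic formulas $t\in X$, with the second-order induction axiom and the full comprehension scheme. Equivalently, it can be formulated with set variables read as characteristic functions of type $\mathbf{N}\to\mathbf{N}$ and $t\in X$ read as $X(t)=1$, comprehension being $\exists f^{\mathbf{N}\to\mathbf{N}}\forall x^{\mathbf{N}}(fx=1\Leftrightarrow\phi(x))$ for arbitrary $\phi$ in which $f$ is not free. *)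

(* Defs.v *)
From Stdlib Require Import List.
Import ListNotations.

(** * Martin-Löf type theory with excluded middle

    Raw syntax with de Bruijn indices; types are the elements of the universes
    [U 0], [U 1], etc. (à la Russell).  The eliminators carry no motive.
    Binding: [Pi A B] and [Sigma A B] bind one variable in [B]; [Lam b] one;
    [Split p d] two in [d] (index 1 the first component, index 0 the second);
    [When c d e] one in each of [d] and [e]; [Natrec d e n] two in [e] (index 1
    the predecessor, index 0 the recursive value); [J d p] one in [d]. *)

Inductive term : Type :=
| Var (n : nat)
| U (i : nat)
| N0 | R0 (c : term)
| N1 | Star | R1 (d c : term)
| N | Zero | Succ (n : term) | Natrec (d e n : term)
| Sum (A B : term) | Inl (a : term) | Inr (b : term) | When (c d e : term)
| Pi (A B : term) | Lam (b : term) | App (f a : term)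
| Sigma (A B : term) | Pair (a b : term) | Split (p d : term)
| Id (A a b : term) | Refl (a : term) | J (d p : term)
| Lem (A : term).

Definition up_ren (r : nat -> nat) (n : nat) : nat :=
  match n with 0 => 0 | S n => S (r n) end.

Fixpoint ren (r : nat -> nat) (t : term) : term :=
  match t with
  | Var n => Var (r n)
  | U i => U i
  | N0 => N0
  | R0 c => R0 (ren r c)
  | N1 => N1
  | Star => Star
  | R1 d c => R1 (ren r d) (ren r c)
  | N => N
  | Zero => Zero
  | Succ n => Succ (ren r n)
  | Natrec d e n => Natrec (ren r d) (ren (up_ren (up_ren r)) e) (ren r n)
  | Sum A B => Sum (ren r A) (ren r B)
  | Inl a => Inl (ren r a)
  | Inr b => Inr (ren r b)
  | When c d e => When (ren r c) (ren (up_ren r) d) (ren (up_ren r) e)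
  | Pi A B => Pi (ren r A) (ren (up_ren r) B)
  | Lam b => Lam (ren (up_ren r) b)
  | App f a => App (ren r f) (ren r a)
  | Sigma A B => Sigma (ren r A) (ren (up_ren r) B)
  | Pair a b => Pair (ren r a) (ren r b)
  | Split p d => Split (ren r p) (ren (up_ren (up_ren r)) d)
  | Id A a b => Id (ren r A) (ren r a) (ren r b)
  | Refl a => Refl (ren r a)
  | J d p => J (ren (up_ren r) d) (ren r p)
  | Lem A => Lem (ren r A)
  end.

Definition up (s : nat -> term) (n : nat) : term :=
  match n with 0 => Var 0 | S n => ren S (s n) end.

Fixpoint subst (s : nat -> term) (t : term) : term :=
  match t with
  | Var n => s n
  | U i => U i
  | N0 => N0
  | R0 c => R0 (subst s c)
  | N1 => N1
  | Star => Star
  | R1 d c => R1 (subst s d) (subst s c)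
  | N => N
  | Zero => Zero
  | Succ n => Succ (subst s n)
  | Natrec d e n => Natrec (subst s d) (subst (up (up s)) e) (subst s n)
  | Sum A B => Sum (subst s A) (subst s B)
  | Inl a => Inl (subst s a)
  | Inr b => Inr (subst s b)
  | When c d e => When (subst s c) (subst (up s) d) (subst (up s) e)
  | Pi A B => Pi (subst s A) (subst (up s) B)
  | Lam b => Lam (subst (up s) b)
  | App f a => App (subst s f) (subst s a)
  | Sigma A B => Sigma (subst s A) (subst (up s) B)
  | Pair a b => Pair (subst s a) (subst s b)
  | Split p d => Split (subst s p) (subst (up (up s)) d)
  | Id A a b => Id (subst s A) (subst s a) (subst s b)
  | Refl a => Refl (subst s a)
  | J d p => J (subst (up s) d) (subst s p)
  | Lem A => Lem (subst s A)
  end.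

Definition scons (a : term) (s : nat -> term) (n : nat) : term :=
  match n with 0 => a | S n => s n end.

Definition shift (k n : nat) : term := Var (k + n).

Notation "a .: s" := (scons a s) (at level 55, right associativity).
Notation wk A := (ren S A).
Notation inst C a := (subst (a .: Var) C).
Notation inst2 C a b := (subst (b .: a .: Var) C).
Notation inst3 C a b c := (subst (c .: b .: a .: Var) C).

Definition Arrow (A B : term) : term := Pi A (wk B).
Definition Prod (A B : term) : term := Sigma A (wk B).
Definition Neg (A : term) : term := Arrow A N0.

(** Contexts list the most recent variable first.  In the rule for [J] the
    motive [C] lives over [x : A, y : A, z : Id A x y]. *)
Definition J_ctx (A : term) (G : list term) : list term :=
  Id (wk (wk A)) (Var 1) (Var 0) :: wk A :: A :: G.

Reserved Notation "'ctx' G" (at level 70, G at level 60).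
Reserved Notation "G |- a # A" (at level 70, a at level 64, A at level 64).
Reserved Notation "G |- a == b # A"
  (at level 70, a at level 64, b at level 64, A at level 64).

(** The judgements [ctx G] (context), [G |- a # A] (typing) and
    [G |- a == b # A] (judgemental equality); "[A] is a type in context [G]" is
    [G |- A # U i] for some [i].  [Pi] has the beta rule but no eta rule.  The
    rules [ty_lem] and [te_lem] are LEM; all the others are MLTT. *)
Inductive wf_ctx : list term -> Prop :=
| ctx_nil : ctx []
| ctx_cons G A i : ctx G -> G |- A # U i -> ctx (A :: G)

with typing : list term -> term -> term -> Prop :=
| ty_var G n A : ctx G -> nth_error G n = Some A ->
    G |- Var n # ren (Nat.add (S n)) A
| ty_conv G a A B i : G |- a # A -> G |- A == B # U i -> G |- a # B
| ty_U G i : ctx G -> G |- U i # U (S i)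
| ty_cumul G A i : G |- A # U i -> G |- A # U (S i)
(* empty type *)
| ty_N0 G i : ctx G -> G |- N0 # U i
| ty_R0 G C c i : N0 :: G |- C # U i -> G |- c # N0 -> G |- R0 c # inst C c
(* unit type *)
| ty_N1 G i : ctx G -> G |- N1 # U i
| ty_Star G : ctx G -> G |- Star # N1
| ty_R1 G C d c i : N1 :: G |- C # U i -> G |- d # inst C Star -> G |- c # N1 ->
    G |- R1 d c # inst C c
(* natural numbers *)
| ty_N G i : ctx G -> G |- N # U i
| ty_Zero G : ctx G -> G |- Zero # N
| ty_Succ G n : G |- n # N -> G |- Succ n # N
| ty_Natrec G C d e n i : N :: G |- C # U i -> G |- d # inst C Zero ->
    C :: N :: G |- e # subst (Succ (Var 1) .: shift 2) C -> G |- n # N ->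
    G |- Natrec d e n # inst C n
(* disjoint sums *)
| ty_Sum G A B i : G |- A # U i -> G |- B # U i -> G |- Sum A B # U i
| ty_Inl G A B a i : G |- B # U i -> G |- a # A -> G |- Inl a # Sum A B
| ty_Inr G A B b i : G |- A # U i -> G |- b # B -> G |- Inr b # Sum A B
| ty_When G A B C c d e i j : G |- A # U j -> G |- B # U j ->
    Sum A B :: G |- C # U i -> G |- c # Sum A B ->
    A :: G |- d # subst (Inl (Var 0) .: shift 1) C ->
    B :: G |- e # subst (Inr (Var 0) .: shift 1) C ->
    G |- When c d e # inst C c
(* dependent products *)
| ty_Pi G A B i : G |- A # U i -> A :: G |- B # U i -> G |- Pi A B # U i
| ty_Lam G A B b i : G |- A # U i -> A :: G |- b # B -> G |- Lam b # Pi A B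
| ty_App G A B f a i : G |- A # U i -> A :: G |- B # U i ->
    G |- f # Pi A B -> G |- a # A -> G |- App f a # inst B a
(* dependent sums *)
| ty_Sigma G A B i : G |- A # U i -> A :: G |- B # U i -> G |- Sigma A B # U i
| ty_Pair G A B a b i : G |- A # U i -> A :: G |- B # U i ->
    G |- a # A -> G |- b # inst B a -> G |- Pair a b # Sigma A B
| ty_Split G A B C p d i j : G |- A # U j -> A :: G |- B # U j ->
    Sigma A B :: G |- C # U i -> G |- p # Sigma A B ->
    B :: A :: G |- d # subst (Pair (Var 1) (Var 0) .: shift 2) C ->
    G |- Split p d # inst C p
(* identity types *)
| ty_Id G A a b i : G |- A # U i -> G |- a # A -> G |- b # A ->
    G |- Id A a b # U i
| ty_Refl G A a i : G |- A # U i -> G |- a # A -> G |- Refl a # Id A a a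
| ty_J G A C d a b p i j : G |- A # U j -> J_ctx A G |- C # U i ->
    A :: G |- d # subst (Refl (Var 0) .: Var 0 .: Var 0 .: shift 1) C ->
    G |- a # A -> G |- b # A -> G |- p # Id A a b ->
    G |- J d p # inst3 C a b p
(* law of excluded middle *)
| ty_lem G A i : G |- A # U i -> G |- Lem A # Sum A (Neg A)

with tmeq : list term -> term -> term -> term -> Prop :=
| te_refl G a A : G |- a # A -> G |- a == a # A
| te_sym G a b A : G |- a == b # A -> G |- b == a # A
| te_trans G a b c A : G |- a == b # A -> G |- b == c # A -> G |- a == c # A
| te_conv G a b A B i : G |- a == b # A -> G |- A == B # U i -> G |- a == b # B
| te_cumul G A B i : G |- A == B # U i -> G |- A == B # U (S i)
(* empty type *)
| te_R0 G C c c' i : N0 :: G |- C # U i -> G |- c == c' # N0 ->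
    G |- R0 c == R0 c' # inst C c
(* unit type *)
| te_R1 G C d d' c c' i : N1 :: G |- C # U i -> G |- d == d' # inst C Star ->
    G |- c == c' # N1 -> G |- R1 d c == R1 d' c' # inst C c
| te_R1_Star G C d i : N1 :: G |- C # U i -> G |- d # inst C Star ->
    G |- R1 d Star == d # inst C Star
(* natural numbers *)
| te_Succ G n n' : G |- n == n' # N -> G |- Succ n == Succ n' # N
| te_Natrec G C d d' e e' n n' i : N :: G |- C # U i ->
    G |- d == d' # inst C Zero ->
    C :: N :: G |- e == e' # subst (Succ (Var 1) .: shift 2) C ->
    G |- n == n' # N -> G |- Natrec d e n == Natrec d' e' n' # inst C n
| te_Natrec_Zero G C d e i : N :: G |- C # U i -> G |- d # inst C Zero ->
    C :: N :: G |- e # subst (Succ (Var 1) .: shift 2) C ->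
    G |- Natrec d e Zero == d # inst C Zero
| te_Natrec_Succ G C d e n i : N :: G |- C # U i -> G |- d # inst C Zero ->
    C :: N :: G |- e # subst (Succ (Var 1) .: shift 2) C -> G |- n # N ->
    G |- Natrec d e (Succ n) == inst2 e n (Natrec d e n) # inst C (Succ n)
(* disjoint sums *)
| te_Sum G A A' B B' i : G |- A == A' # U i -> G |- B == B' # U i ->
    G |- Sum A B == Sum A' B' # U i
| te_Inl G A B a a' i : G |- B # U i -> G |- a == a' # A ->
    G |- Inl a == Inl a' # Sum A B
| te_Inr G A B b b' i : G |- A # U i -> G |- b == b' # B ->
    G |- Inr b == Inr b' # Sum A B
| te_When G A B C c c' d d' e e' i j : G |- A # U j -> G |- B # U j ->
    Sum A B :: G |- C # U i -> G |- c == c' # Sum A B ->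
    A :: G |- d == d' # subst (Inl (Var 0) .: shift 1) C ->
    B :: G |- e == e' # subst (Inr (Var 0) .: shift 1) C ->
    G |- When c d e == When c' d' e' # inst C c
| te_When_Inl G A B C a d e i j : G |- A # U j -> G |- B # U j ->
    Sum A B :: G |- C # U i -> G |- a # A ->
    A :: G |- d # subst (Inl (Var 0) .: shift 1) C ->
    B :: G |- e # subst (Inr (Var 0) .: shift 1) C ->
    G |- When (Inl a) d e == inst d a # inst C (Inl a)
| te_When_Inr G A B C b d e i j : G |- A # U j -> G |- B # U j ->
    Sum A B :: G |- C # U i -> G |- b # B ->
    A :: G |- d # subst (Inl (Var 0) .: shift 1) C ->
    B :: G |- e # subst (Inr (Var 0) .: shift 1) C ->
    G |- When (Inr b) d e == inst e b # inst C (Inr b)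
(* dependent products *)
| te_Pi G A A' B B' i : G |- A # U i -> G |- A == A' # U i ->
    A :: G |- B == B' # U i -> G |- Pi A B == Pi A' B' # U i
| te_Lam G A B b b' i : G |- A # U i -> A :: G |- b == b' # B ->
    G |- Lam b == Lam b' # Pi A B
| te_App G A B f f' a a' i : G |- A # U i -> A :: G |- B # U i ->
    G |- f == f' # Pi A B -> G |- a == a' # A ->
    G |- App f a == App f' a' # inst B a
| te_beta G A B b a i : G |- A # U i -> A :: G |- b # B -> G |- a # A ->
    G |- App (Lam b) a == inst b a # inst B a
(* dependent sums *)
| te_Sigma G A A' B B' i : G |- A # U i -> G |- A == A' # U i ->
    A :: G |- B == B' # U i -> G |- Sigma A B == Sigma A' B' # U i
| te_Pair G A B a a' b b' i : G |- A # U i -> A :: G |- B # U i ->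
    G |- a == a' # A -> G |- b == b' # inst B a ->
    G |- Pair a b == Pair a' b' # Sigma A B
| te_Split G A B C p p' d d' i j : G |- A # U j -> A :: G |- B # U j ->
    Sigma A B :: G |- C # U i -> G |- p == p' # Sigma A B ->
    B :: A :: G |- d == d' # subst (Pair (Var 1) (Var 0) .: shift 2) C ->
    G |- Split p d == Split p' d' # inst C p
| te_Split_Pair G A B C a b d i j : G |- A # U j -> A :: G |- B # U j ->
    Sigma A B :: G |- C # U i -> G |- a # A -> G |- b # inst B a ->
    B :: A :: G |- d # subst (Pair (Var 1) (Var 0) .: shift 2) C ->
    G |- Split (Pair a b) d == inst2 d a b # inst C (Pair a b)
(* identity types *)
| te_Id G A A' a a' b b' i : G |- A == A' # U i -> G |- a == a' # A ->
    G |- b == b' # A -> G |- Id A a b == Id A' a' b' # U i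
| te_Refl G A a a' i : G |- A # U i -> G |- a == a' # A ->
    G |- Refl a == Refl a' # Id A a a
| te_J G A C d d' a b p p' i j : G |- A # U j -> J_ctx A G |- C # U i ->
    A :: G |- d == d' # subst (Refl (Var 0) .: Var 0 .: Var 0 .: shift 1) C ->
    G |- a # A -> G |- b # A -> G |- p == p' # Id A a b ->
    G |- J d p == J d' p' # inst3 C a b p
| te_J_Refl G A C d a i j : G |- A # U j -> J_ctx A G |- C # U i ->
    A :: G |- d # subst (Refl (Var 0) .: Var 0 .: Var 0 .: shift 1) C ->
    G |- a # A ->
    G |- J d (Refl a) == inst d a # inst3 C a a (Refl a)
(* law of excluded middle *)
| te_lem G A A' i : G |- A == A' # U i ->
    G |- Lem A == Lem A' # Sum A (Neg A)

where "'ctx' G" := (wf_ctx G)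
and "G |- a # A" := (typing G a A)
and "G |- a == b # A" := (tmeq G a b A).

(** * Classical second-order arithmetic

    A two-sorted language.  Both sorts of variables share one sequence of
    de Bruijn indices, and a context records the sort of each index.  The only
    expressions of sort [sSet] are variables, so substituting a well-sorted
    expression for a set variable is a renaming. *)

Inductive sort : Type := sNum | sSet.

Inductive expr : Type :=
| eVar (n : nat)
| eZero | eSucc (t : expr) | ePlus (t u : expr) | eTimes (t u : expr).

Inductive form : Type :=
| fEq (t u : expr)
| fMem (t X : expr)
| fBot
| fImp (p q : form) | fAnd (p q : form) | fOr (p q : form)
| fAll (s : sort) (p : form) | fEx (s : sort) (p : form).

Definition fNot (p : form) : form := fImp p fBot.
Definition fIff (p q : form) : form := fAnd (fImp p q) (fImp q p).

Fixpoint has_sort (V : list sort) (t : expr) (s : sort) : Prop :=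
  match t with
  | eVar n => nth_error V n = Some s
  | eZero => s = sNum
  | eSucc t => s = sNum /\ has_sort V t sNum
  | ePlus t u | eTimes t u => s = sNum /\ has_sort V t sNum /\ has_sort V u sNum
  end.

Fixpoint wf_form (V : list sort) (p : form) : Prop :=
  match p with
  | fEq t u => has_sort V t sNum /\ has_sort V u sNum
  | fMem t X => has_sort V t sNum /\ has_sort V X sSet
  | fBot => True
  | fImp p q | fAnd p q | fOr p q => wf_form V p /\ wf_form V q
  | fAll s p | fEx s p => wf_form (s :: V) p
  end.

Fixpoint esubst (s : nat -> expr) (t : expr) : expr :=
  match t with
  | eVar n => s n
  | eZero => eZero
  | eSucc t => eSucc (esubst s t)
  | ePlus t u => ePlus (esubst s t) (esubst s u)
  | eTimes t u => eTimes (esubst s t) (esubst s u)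
  end.

Definition eup (s : nat -> expr) (n : nat) : expr :=
  match n with 0 => eVar 0 | S n => esubst (fun k => eVar (S k)) (s n) end.

Fixpoint fsubst (s : nat -> expr) (p : form) : form :=
  match p with
  | fEq t u => fEq (esubst s t) (esubst s u)
  | fMem t X => fMem (esubst s t) (esubst s X)
  | fBot => fBot
  | fImp p q => fImp (fsubst s p) (fsubst s q)
  | fAnd p q => fAnd (fsubst s p) (fsubst s q)
  | fOr p q => fOr (fsubst s p) (fsubst s q)
  | fAll a p => fAll a (fsubst (eup s) p)
  | fEx a p => fEx a (fsubst (eup s) p)
  end.

Definition fren (r : nat -> nat) (p : form) : form := fsubst (fun n => eVar (r n)) p.
Definition fwk (p : form) : form := fren S p.
Definition finst (p : form) (t : expr) : form :=
  fsubst (fun n => match n with 0 => t | S n => eVar n end) p.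

(** In [ax_comprehension], [p] is a formula in the variable [x] (index 0) and
    arbitrary parameters of both sorts; the renaming skips the index of the
    new set variable, which therefore does not occur in it. *)
Inductive PA2_axiom (V : list sort) : form -> Prop :=
| ax_succ_neq_zero :
    PA2_axiom V (fAll sNum (fNot (fEq (eSucc (eVar 0)) eZero)))
| ax_succ_inj :
    PA2_axiom V (fAll sNum (fAll sNum
      (fImp (fEq (eSucc (eVar 1)) (eSucc (eVar 0))) (fEq (eVar 1) (eVar 0)))))
| ax_plus_zero :
    PA2_axiom V (fAll sNum (fEq (ePlus (eVar 0) eZero) (eVar 0)))
| ax_plus_succ :
    PA2_axiom V (fAll sNum (fAll sNum
      (fEq (ePlus (eVar 1) (eSucc (eVar 0))) (eSucc (ePlus (eVar 1) (eVar 0))))))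
| ax_times_zero :
    PA2_axiom V (fAll sNum (fEq (eTimes (eVar 0) eZero) eZero))
| ax_times_succ :
    PA2_axiom V (fAll sNum (fAll sNum
      (fEq (eTimes (eVar 1) (eSucc (eVar 0)))
           (ePlus (eTimes (eVar 1) (eVar 0)) (eVar 1)))))
| ax_induction :
    PA2_axiom V (fAll sSet
      (fImp (fAnd (fMem eZero (eVar 0))
                  (fAll sNum (fImp (fMem (eVar 0) (eVar 1))
                                   (fMem (eSucc (eVar 0)) (eVar 1)))))
            (fAll sNum (fMem (eVar 0) (eVar 1)))))
| ax_comprehension p : wf_form (sNum :: V) p ->
    PA2_axiom V (fEx sSet (fAll sNum
      (fIff (fMem (eVar 0) (eVar 1)) (fren (up_ren S) p)))).

(** Natural deduction for classical two-sorted logic with equality on numbers: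
    [PA2 V H p] says that [p] is derivable from the hypotheses [H], all with
    free variables in [V]. *)
Inductive PA2 : list sort -> list form -> form -> Prop :=
| pa_axiom V H p : PA2_axiom V p -> PA2 V H p
| pa_hyp V H p : In p H -> PA2 V H p
| pa_bot_e V H p : wf_form V p -> PA2 V H fBot -> PA2 V H p
| pa_em V H p : wf_form V p -> PA2 V H (fOr p (fNot p))
| pa_imp_i V H p q : wf_form V p -> PA2 V (p :: H) q -> PA2 V H (fImp p q)
| pa_imp_e V H p q : PA2 V H (fImp p q) -> PA2 V H p -> PA2 V H q
| pa_and_i V H p q : PA2 V H p -> PA2 V H q -> PA2 V H (fAnd p q)
| pa_and_e1 V H p q : PA2 V H (fAnd p q) -> PA2 V H p
| pa_and_e2 V H p q : PA2 V H (fAnd p q) -> PA2 V H q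
| pa_or_i1 V H p q : wf_form V q -> PA2 V H p -> PA2 V H (fOr p q)
| pa_or_i2 V H p q : wf_form V p -> PA2 V H q -> PA2 V H (fOr p q)
| pa_or_e V H p q r : PA2 V H (fOr p q) -> PA2 V (p :: H) r -> PA2 V (q :: H) r ->
    PA2 V H r
| pa_all_i V H s p : PA2 (s :: V) (map fwk H) p -> PA2 V H (fAll s p)
| pa_all_e V H s p t : has_sort V t s -> PA2 V H (fAll s p) -> PA2 V H (finst p t)
| pa_ex_i V H s p t : wf_form (s :: V) p -> has_sort V t s -> PA2 V H (finst p t) ->
    PA2 V H (fEx s p)
| pa_ex_e V H s p q : wf_form V q -> PA2 V H (fEx s p) ->
    PA2 (s :: V) (p :: map fwk H) (fwk q) -> PA2 V H q
| pa_eq_refl V H t : has_sort V t sNum -> PA2 V H (fEq t t)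
| pa_eq_subst V H p t u : wf_form (sNum :: V) p -> PA2 V H (fEq t u) ->
    PA2 V H (finst p t) -> PA2 V H (finst p u).

(** * Interpretations of the language of [PA2] in type theory

    Propositions are read as types and numbers as elements of [N], with zero,
    successor and equality as in type theory.  It remains to choose addition
    and multiplication (open terms in two variables of type [N], index 1 the
    left argument), a closed type of sets, and membership (an open type in
    [x : N], index 1, and [X : i_set], index 0). *)
Record interpretation : Type := {
  i_plus : term;
  i_times : term;
  i_set : term;
  i_mem : term }.

Section Translation.
Context (I : interpretation).

Fixpoint tr_expr (t : expr) : term :=
  match t with
  | eVar n => Var n
  | eZero => Zero
  | eSucc t => Succ (tr_expr t)
  | ePlus t u => inst2 (i_plus I) (tr_expr t) (tr_expr u)
  | eTimes t u => inst2 (i_times I) (tr_expr t) (tr_expr u)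
  end.

Definition tr_sort (s : sort) : term :=
  match s with sNum => N | sSet => i_set I end.

Fixpoint tr_form (p : form) : term :=
  match p with
  | fEq t u => Id N (tr_expr t) (tr_expr u)
  | fMem t X => inst2 (i_mem I) (tr_expr t) (tr_expr X)
  | fBot => N0
  | fImp p q => Arrow (tr_form p) (tr_form q)
  | fAnd p q => Prod (tr_form p) (tr_form q)
  | fOr p q => Sum (tr_form p) (tr_form q)
  | fAll s p => Pi (tr_sort s) (tr_form p)
  | fEx s p => Sigma (tr_sort s) (tr_form p)
  end.

(** [i_set I] is closed, so [map tr_sort V] is a context. *)
Record interprets_PA2 : Prop := {
  ip_plus : [N; N] |- i_plus I # N;
  ip_times : [N; N] |- i_times I # N;
  ip_set : exists i, [] |- i_set I # U i;
  ip_mem : exists i, [i_set I; N] |- i_mem I # U i;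
  ip_sound : forall (V : list sort) (p : form),
    wf_form V p -> PA2 V [] p -> exists a, map tr_sort V |- a # tr_form p }.
End Translation.

(* Main.v *)
From Stdlib Require Import List.
Require Import Defs.
Import ListNotations.

(** Read sets as functions [N -> N] and [t \in X] as [Id N (X t) 1].
    Formulas then become types in [U 0], and first-order reasoning is
    propositions-as-types with [Lem] for the classical step.  Comprehension for an
    arbitrary formula [p(x)] is witnessed by the function that decides [p(x)] with
    [Lem] and returns 1 or 0: since [Lem] applies to every type, including those
    that quantify over [N -> N], no stratification of formulas is needed. *)

(** [Lem] has no computation rule, so [When (Lem A) (Succ Zero) Zero] is stuck, and membership in
    the comprehension witness cannot be compared with the formula by computation. The comparison is
    therefore made for a variable decision [c : A + (A -> N0)] by dependent elimination: in either
    branch [c] is an injection, the characteristic value computes, and the result is specialised to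
    [Lem A] at the end. The other obstacle is the movement of terms between contexts. Typing
    derivations are never transported: statements about a formula range over every context [G] with
    a renaming [r] that locates the variables in [G], and the typing of the formula is rebuilt from
    its well-formedness wherever it is needed. A proof term known in one context only is passed as
    an argument to a function whose body sees a variable in its place. *)

(** * Substitution calculus of raw terms *)

Lemma up_ext s s' : (forall n, s n = s' n) -> forall n, up s n = up s' n.
Proof. intros H [|n]; simpl; [reflexivity | now rewrite H]. Qed.

Lemma subst_ext t : forall s s', (forall n, s n = s' n) -> subst s t = subst s' t.
Proof. induction t; intros s s' H; simpl; f_equal; auto using up_ext. Qed.

(** Lets every law of the calculus be stated for substitutions. [H1] and [H2] carry the induction
    hypothesis under one and two binders, the only numbers of variables that a constructor binds;
    the next fusion laws repeat this scheme. *)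
Lemma ren_as_subst t : forall r, ren r t = subst (fun n => Var (r n)) t.
Proof.
  assert (U : forall r n, Var (up_ren r n) = up (fun k => Var (r k)) n)
    by (intros r [|n]; reflexivity).
  assert (H1 : forall t, (forall r, ren r t = subst (fun n => Var (r n)) t) ->
    forall r, ren (up_ren r) t = subst (up (fun n => Var (r n))) t)
    by (intros u E r; rewrite E; apply subst_ext, U).
  assert (H2 : forall t, (forall r, ren r t = subst (fun n => Var (r n)) t) ->
    forall r, ren (up_ren (up_ren r)) t = subst (up (up (fun n => Var (r n)))) t)
    by (intros u E r; rewrite H1 by assumption; apply subst_ext, up_ext, U).
  induction t; intros r; simpl; f_equal; auto.
Qed.

Lemma subst_ren t : forall r s, subst s (ren r t) = subst (fun n => s (r n)) t.
Proof.
  assert (U : forall r s n, up s (up_ren r n) = up (fun k => s (r k)) n)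
    by (intros r s [|n]; reflexivity).
  assert (H1 : forall t, (forall r s, subst s (ren r t) = subst (fun n => s (r n)) t) ->
    forall r s, subst (up s) (ren (up_ren r) t) = subst (up (fun n => s (r n))) t)
    by (intros u E r s; rewrite E; apply subst_ext, U).
  assert (H2 : forall t, (forall r s, subst s (ren r t) = subst (fun n => s (r n)) t) ->
    forall r s, subst (up (up s)) (ren (up_ren (up_ren r)) t)
      = subst (up (up (fun n => s (r n)))) t)
    by (intros u E r s; rewrite H1 by assumption; apply subst_ext, up_ext, U).
  induction t; intros r s; simpl; f_equal; auto.
Qed.

Lemma ren_up_ren_wk r t : ren (up_ren r) (wk t) = wk (ren r t).
Proof.
  rewrite (ren_as_subst _ (up_ren r)), (ren_as_subst (ren r t)), !subst_ren.
  reflexivity.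
Qed.

Lemma subst_comp t : forall s s', subst s (subst s' t) = subst (fun n => subst s (s' n)) t.
Proof.
  (* Renaming after substitution has to be settled before the general law, because [up] is defined
     with [ren S]. *)
  assert (R : forall r s t, ren r (subst s t) = subst (fun n => ren r (s n)) t).
  { intros r s u; revert u r s.
    assert (U : forall r s n, ren (up_ren r) (up s n) = up (fun k => ren r (s k)) n)
      by (intros r s [|n]; [reflexivity | apply ren_up_ren_wk]).
    assert (H1 : forall t, (forall r s, ren r (subst s t) = subst (fun n => ren r (s n)) t) ->
      forall r s, ren (up_ren r) (subst (up s) t) = subst (up (fun n => ren r (s n))) t)
      by (intros u E r s; rewrite E; apply subst_ext, U).
    assert (H2 : forall t, (forall r s, ren r (subst s t) = subst (fun n => ren r (s n)) t) ->
      forall r s, ren (up_ren (up_ren r)) (subst (up (up s)) t)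
        = subst (up (up (fun n => ren r (s n)))) t)
      by (intros u E r s; rewrite H1 by assumption; apply subst_ext, up_ext, U).
    induction u; intros r s; simpl; f_equal; auto. }
  assert (U : forall s s' n, subst (up s) (up s' n) = up (fun k => subst s (s' k)) n).
  { intros s s' [|n]; [reflexivity | simpl]. rewrite subst_ren, R. reflexivity. }
  assert (H1 : forall t, (forall s s', subst s (subst s' t) = subst (fun n => subst s (s' n)) t) ->
    forall s s', subst (up s) (subst (up s') t) = subst (up (fun n => subst s (s' n))) t)
    by (intros u E s s'; rewrite E; apply subst_ext, U).
  assert (H2 : forall t, (forall s s', subst s (subst s' t) = subst (fun n => subst s (s' n)) t) ->
    forall s s', subst (up (up s)) (subst (up (up s')) t)
      = subst (up (up (fun n => subst s (s' n)))) t)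
    by (intros u E s s'; rewrite H1 by assumption; apply subst_ext, up_ext, U).
  induction t; intros s s'; simpl; f_equal; auto.
Qed.

Lemma subst_var t : forall s, (forall n, s n = Var n) -> subst s t = t.
Proof.
  assert (U : forall s, (forall n, s n = Var n) -> forall n, up s n = Var n)
    by (intros s H [|n]; simpl; [|rewrite H]; reflexivity).
  induction t; intros s H; simpl; f_equal; auto.
Qed.

Definition wkr (r : nat -> nat) (n : nat) : nat := S (r n).

(* Both sides of an equation between iterated substitutions and renamings of one
   term are fused to a single substitution, and these are compared pointwise. *)
Ltac fuse := rewrite ?ren_as_subst, ?subst_comp; simpl.
Ltac pointwise :=
  first [ apply subst_ext | apply subst_var | symmetry; apply subst_var ];
  let n := fresh "n" in intros n;
  repeat (first [reflexivity | progress fuse | destruct n as [|n]]).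
Ltac syntactic :=
  unfold wkr, Neg, Prod, Arrow; simpl; try reflexivity;
  repeat match goal with
  | |- Pi _ _ = Pi _ _ => f_equal
  | |- Sigma _ _ = Sigma _ _ => f_equal
  | |- Sum _ _ = Sum _ _ => f_equal
  | |- Id _ _ _ = Id _ _ _ => f_equal
  | |- When _ _ _ = When _ _ _ => f_equal
  | |- App _ _ = App _ _ => f_equal
  | |- Lem _ = Lem _ => f_equal
  | |- Lam _ = Lam _ => f_equal
  | |- Succ _ = Succ _ => f_equal
  | |- Natrec _ _ _ = Natrec _ _ _ => f_equal
  end;
  try reflexivity; fuse; try reflexivity; pointwise.

(** * The chosen interpretation *)

(** Recursion on the right argument (index 0), here and for multiplication, makes the recursion
    equations of the axioms hold by judgemental computation. *)
Definition plus_term : term := Natrec (Var 1) (Succ (Var 0)) (Var 0).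
(** In the outer step, index 0 is the recursive value and index 3 the left factor, beyond the
    predecessor and the right factor; the inner recursion adds the left factor to the recursive
    value. *)
Definition times_term : term :=
  Natrec Zero (Natrec (Var 0) (Succ (Var 0)) (Var 3)) (Var 0).
Definition fun_sets : interpretation :=
  {| i_plus := plus_term; i_times := times_term; i_set := Arrow N N;
     i_mem := Id N (App (Var 0) (Var 1)) (Succ Zero) |}.

Notation tre := (tr_expr fun_sets).
Notation trs := (tr_sort fun_sets).
Notation trf := (tr_form fun_sets).

Lemma tr_expr_esubst t s : tre (esubst s t) = subst (fun n => tre (s n)) (tre t).
Proof.
  induction t; simpl; try congruence; cbn [fun_sets i_plus i_times plus_term times_term];
    simpl; rewrite IHt1, IHt2; reflexivity || syntactic.
Qed.

Lemma tr_form_fsubst p : forall s, trf (fsubst s p) = subst (fun n => tre (s n)) (trf p).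
Proof.
  assert (U : forall s n, tre (eup s n) = up (fun k => tre (s k)) n).
  { intros s [|n]; [reflexivity | simpl]. rewrite tr_expr_esubst, (ren_as_subst (tre _)).
    reflexivity. }
  induction p; intros s0; cbn -[fun_sets]; rewrite ?IHp, ?IHp1, ?IHp2, ?tr_expr_esubst.
  1-5,6: simpl; syntactic.
  all: f_equal; try (now destruct s); apply subst_ext, U.
Qed.

Lemma tr_form_fwk p : trf (fwk p) = wk (trf p).
Proof. unfold fwk, fren. rewrite tr_form_fsubst. syntactic. Qed.

Lemma tr_form_finst p t : trf (finst p t) = inst (trf p) (tre t).
Proof. unfold finst. rewrite tr_form_fsubst. syntactic. Qed.

Lemma ren_tr_sort r s : ren r (trs s) = trs s.
Proof. now destruct s. Qed.

(** * Derived typing rules *)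

Lemma ty_eq G a A B : G |- a # A -> A = B -> G |- a # B.
Proof. now intros H <-. Qed.

(** The type of a variable as seen from the whole of [G], separated from [ty_var] so that it passes
    to longer contexts by pure syntax. *)
Definition lookup (G : list term) (n : nat) (T : term) : Prop :=
  exists A, nth_error G n = Some A /\ ren (Nat.add (S n)) A = T.

Lemma lookup_here G A : lookup (A :: G) 0 (wk A).
Proof. now exists A. Qed.

Lemma lookup_wk G B n T : lookup G n T -> lookup (B :: G) (S n) (wk T).
Proof. intros (A & HA & <-). exists A; split; [exact HA | syntactic]. Qed.

Lemma ty_lookup G n T : ctx G -> lookup G n T -> G |- Var n # T.
Proof. intros HG (A & HA & <-). now apply ty_var. Qed.

Lemma ty_Natrec_N G d e n : ctx G ->
  G |- d # N -> N :: N :: G |- e # N -> G |- n # N -> G |- Natrec d e n # N.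
Proof.
  intros HG Hd He Hn. apply (ty_Natrec G N d e n 0); auto.
  apply ty_N. eapply ctx_cons; [|apply (ty_N _ 0)]; auto.
Qed.

Lemma te_Natrec_N_Zero G d e : ctx G ->
  G |- d # N -> N :: N :: G |- e # N -> G |- Natrec d e Zero == d # N.
Proof.
  intros HG Hd He. apply (te_Natrec_Zero G N d e 0); auto.
  apply ty_N. eapply ctx_cons; [|apply (ty_N _ 0)]; auto.
Qed.

Lemma te_Natrec_N_Succ G d e n : ctx G ->
  G |- d # N -> N :: N :: G |- e # N -> G |- n # N ->
  G |- Natrec d e (Succ n) == inst2 e n (Natrec d e n) # N.
Proof.
  intros HG Hd He Hn. apply (te_Natrec_Succ G N d e n 0); auto.
  apply ty_N. eapply ctx_cons; [|apply (ty_N _ 0)]; auto.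
Qed.

Lemma ty_Arrow G A B i : G |- A # U i -> A :: G |- wk B # U i -> G |- Arrow A B # U i.
Proof. apply ty_Pi. Qed.

Lemma ty_App_Arrow G A B f a i : G |- A # U i -> A :: G |- wk B # U i ->
  G |- f # Arrow A B -> G |- a # A -> G |- App f a # B.
Proof.
  intros HA HB Hf Ha. eapply ty_eq; [exact (ty_App G A _ f a i HA HB Hf Ha) | syntactic].
Qed.

Lemma ty_R0_const G C c i : N0 :: G |- wk C # U i -> G |- c # N0 -> G |- R0 c # C.
Proof. intros HC Hc. eapply ty_eq; [exact (ty_R0 G _ c i HC Hc) | syntactic]. Qed.

(** Directed by the subject term. Open universe levels are set to 0, except for the context entry
    [U 0], which lives in [U 1] and arises from the elimination of numbers into [U 0]. *)
Ltac ty := simpl; try assumption;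
  lazymatch goal with
  | |- wf_ctx (U 0 :: _) => apply (ctx_cons _ _ 1); ty
  | |- wf_ctx (_ :: _) => eapply (ctx_cons _ _ 0); ty
  | |- typing _ (U _) _ => apply ty_U; ty
  | |- typing _ N _ => apply ty_N; ty
  | |- typing _ N0 _ => apply ty_N0; ty
  | |- typing _ N1 _ => apply ty_N1; ty
  | |- typing _ Star _ => apply ty_Star; ty
  | |- typing _ Zero _ => apply ty_Zero; ty
  | |- typing _ (Succ _) _ => apply ty_Succ; ty
  | |- typing _ (Natrec _ _ _) N => apply ty_Natrec_N; ty
  | |- typing _ (Sum _ _) (U _) => apply ty_Sum; ty
  | |- typing _ (Id _ _ _) (U _) => apply ty_Id; ty
  | |- typing _ (Refl _) (Id N _ _) => apply (ty_Refl _ _ _ 0); ty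
  | |- typing _ (Arrow _ _) (U _) => apply ty_Arrow; ty
  | |- typing _ (Pi _ _) (U _) => apply ty_Pi; ty
  | |- typing _ (Sigma _ _) (U _) => apply ty_Sigma; ty
  | |- typing _ (Lam _) (Pi _ _) => apply (ty_Lam _ _ _ _ 0); ty
  | |- typing _ (Lam _) (Arrow _ _) => apply (ty_Lam _ _ _ _ 0); ty
  | |- typing _ (App (Var _) _) N => apply (ty_App_Arrow _ N N _ _ 0); ty
  | |- typing _ (Var _) _ =>
      apply ty_lookup; [ty | eexists; split; [reflexivity | first [reflexivity | syntactic]]]
  | |- _ => idtac
  end.

Lemma ctx_cons0 G A : ctx G -> G |- A # U 0 -> ctx (A :: G).
Proof. apply ctx_cons. Qed.

Lemma ty_Var0 G A B : ctx (A :: G) -> wk A = B -> A :: G |- Var 0 # B.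
Proof. intros HG <-. exact (ty_lookup _ _ _ HG (lookup_here _ _)). Qed.

Lemma ty_Var1 G A A' B : ctx (A' :: A :: G) -> wk (wk A) = B -> A' :: A :: G |- Var 1 # B.
Proof. intros HG <-. exact (ty_lookup _ _ _ HG (lookup_wk _ _ _ _ (lookup_here _ _))). Qed.

(** Only inhabitation matters for soundness, so the rules are restated without naming the proof
    term; the construction of the body may assume that the extended context is well formed. *)
Lemma ex_Lam G A B i : ctx G -> G |- A # U i ->
  (ctx (A :: G) -> exists b, A :: G |- b # B) -> exists a, G |- a # Pi A B.
Proof.
  intros HG HA [b Hb]; [eapply ctx_cons; eauto|].
  exists (Lam b). exact (ty_Lam _ _ _ _ _ HA Hb).
Qed.

Lemma ex_Pair G A B a i : G |- A # U i -> A :: G |- B # U i -> G |- a # A ->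
  (exists b, G |- b # inst B a) -> exists p, G |- p # Sigma A B.
Proof.
  intros HA HB Ha [b Hb]. exists (Pair a b). exact (ty_Pair _ _ _ _ _ _ HA HB Ha Hb).
Qed.

Lemma ex_Split G A B C p i : G |- A # U i -> A :: G |- B # U i ->
  Sigma A B :: G |- wk C # U i -> G |- p # Sigma A B ->
  (exists d, B :: A :: G |- d # wk (wk C)) -> exists a, G |- a # C.
Proof.
  intros HA HB HC Hp [d Hd]. exists (Split p d).
  eapply ty_eq; [apply (ty_Split _ _ _ _ _ _ _ _ HA HB HC Hp)|syntactic].
  eapply ty_eq; [exact Hd | syntactic].
Qed.

Lemma ex_When G A B C c i : G |- A # U i -> G |- B # U i ->
  Sum A B :: G |- wk C # U i -> G |- c # Sum A B ->
  (exists d, A :: G |- d # wk C) -> (exists e, B :: G |- e # wk C) ->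
  exists a, G |- a # C.
Proof.
  intros HA HB HC Hc [d Hd] [e He]. exists (When c d e).
  eapply ty_eq; [apply (ty_When _ _ _ _ _ _ _ _ _ HA HB HC Hc)|syntactic];
    (eapply ty_eq; [eassumption | syntactic]).
Qed.

Lemma ty_When_N G A B c : G |- A # U 0 -> G |- B # U 0 -> ctx G ->
  G |- c # Sum A B -> G |- When c (Succ Zero) Zero # N.
Proof.
  intros HA HB HG Hc.
  assert (ctx (A :: G) /\ ctx (B :: G)) as [] by (split; eapply ctx_cons; eauto).
  apply (ty_When G A B N _ _ _ 0 0); ty.
Qed.

Lemma te_When_N_Inl G A B a : G |- A # U 0 -> G |- B # U 0 -> ctx G ->
  G |- a # A -> G |- When (Inl a) (Succ Zero) Zero == Succ Zero # N.
Proof.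
  intros HA HB HG Ha.
  assert (ctx (A :: G) /\ ctx (B :: G)) as [] by (split; eapply ctx_cons; eauto).
  apply (te_When_Inl G A B N a (Succ Zero) Zero 0 0); ty.
Qed.

Lemma te_When_N_Inr G A B b : G |- A # U 0 -> G |- B # U 0 -> ctx G ->
  G |- b # B -> G |- When (Inr b) (Succ Zero) Zero == Zero # N.
Proof.
  intros HA HB HG Hb.
  assert (ctx (A :: G) /\ ctx (B :: G)) as [] by (split; eapply ctx_cons; eauto).
  apply (te_When_Inr G A B N b (Succ Zero) Zero 0 0); ty.
Qed.

Lemma ty_Neg G A : ctx G -> G |- A # U 0 -> G |- Neg A # U 0.
Proof. intros HG HA. pose proof (ctx_cons _ _ 0 HG HA). unfold Neg. ty. Qed.

(** * Numbers *)

Lemma Id_conv G a a' b b' p :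
  G |- a == a' # N -> G |- b == b' # N -> ctx G ->
  G |- p # Id N a b -> G |- p # Id N a' b'.
Proof.
  intros Ha Hb HG Hp. apply (ty_conv _ _ _ _ 0 Hp).
  apply te_Id; auto. apply te_refl; ty.
Qed.

Lemma Id_of_conv G a b : ctx G -> G |- a # N -> G |- a == b # N -> G |- Refl a # Id N a b.
Proof.
  intros HG Ha E. apply (Id_conv _ a a a b); auto.
  - now apply te_refl.
  - ty.
Qed.

Lemma Id_sym G a b p : ctx G -> G |- a # N -> G |- b # N -> G |- p # Id N a b ->
  G |- J (Refl (Var 0)) p # Id N b a.
Proof.
  intros HG Ha Hb Hp.
  apply (ty_J G N (Id N (Var 1) (Var 2)) (Refl (Var 0)) a b p 0 0); unfold J_ctx; ty.
Qed.

(* Elimination into [U 0] separates zero ([N0]) from successors ([N1]). *)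
Lemma ty_code G n : ctx G -> G |- n # N -> G |- Natrec N0 N1 n # U 0.
Proof.
  intros HG Hn. apply (ty_Natrec G (U 0) N0 N1 n 1); ty.
Qed.

Lemma te_code_Zero G : ctx G -> G |- Natrec N0 N1 Zero == N0 # U 0.
Proof.
  intros HG. apply (te_Natrec_Zero G (U 0) N0 N1 1); ty.
Qed.

Lemma te_code_Succ G n : ctx G -> G |- n # N -> G |- Natrec N0 N1 (Succ n) == N1 # U 0.
Proof.
  intros HG Hn. apply (te_Natrec_Succ G (U 0) N0 N1 n 1); ty.
Qed.

(** [J] of the identity function is transport along [p] in the family [Natrec N0 N1]; it carries
    [Star], an element of the code of a successor, to the code of zero. *)
Lemma Succ_neq_Zero G n p : ctx G -> G |- n # N -> G |- p # Id N (Succ n) Zero ->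
  G |- App (J (Lam (Var 0)) p) Star # N0.
Proof.
  intros HG Hn Hp.
  assert (Hf : G |- J (Lam (Var 0)) p # Arrow (Natrec N0 N1 (Succ n)) (Natrec N0 N1 Zero)).
  { apply (ty_J G N (Arrow (Natrec N0 N1 (Var 2)) (Natrec N0 N1 (Var 1)))
      (Lam (Var 0)) (Succ n) Zero p 0 0); unfold J_ctx; ty.
    all: repeat (apply ty_code; ty). }
  apply (ty_conv _ _ (Natrec N0 N1 Zero) _ 0); [|now apply te_code_Zero].
  apply (ty_App_Arrow _ (Natrec N0 N1 (Succ n)) _ _ _ 0); auto.
  - apply ty_code; ty.
  - simpl. repeat (apply ty_code; ty).
  - apply (ty_conv _ _ N1 _ 0); [ty | now apply te_sym, te_code_Succ].
Qed.

Lemma Zero_eq_Succ_elim G n p C : ctx G -> G |- n # N -> G |- p # Id N Zero (Succ n) ->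
  N0 :: G |- wk C # U 0 -> exists a, G |- a # C.
Proof.
  intros HG Hn Hp HC. exists (R0 (App (J (Lam (Var 0)) (J (Refl (Var 0)) p)) Star)).
  apply (ty_R0_const _ _ _ 0 HC).
  apply (Succ_neq_Zero _ n); auto. apply Id_sym; ty.
Qed.

(** Congruence under the predecessor [Natrec Zero (Var 1)], which takes [Succ n] back to [n]
    judgementally, so that conversion of the identity type finishes. *)
Lemma Succ_inj G a b p : ctx G -> G |- a # N -> G |- b # N ->
  G |- p # Id N (Succ a) (Succ b) ->
  G |- J (Refl (Natrec Zero (Var 1) (Var 0))) p # Id N a b.
Proof.
  intros HG Ha Hb Hp.
  assert (E : forall n, G |- n # N -> G |- Natrec Zero (Var 1) (Succ n) == n # N)
    by (intros n Hn; apply te_Natrec_N_Succ; ty).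
  apply (Id_conv _ _ _ _ _ _ (E a Ha) (E b Hb) HG).
  apply (ty_J G N (Id N (Natrec Zero (Var 1) (Var 2)) (Natrec Zero (Var 1) (Var 1)))
    (Refl (Natrec Zero (Var 1) (Var 0))) (Succ a) (Succ b) p 0 0); unfold J_ctx; ty.
Qed.

(** * Formulas as types *)

(** [G] may interleave the variables of [V] with proofs of hypotheses; [r] gives the position in [G]
    of each variable. *)
Definition env (V : list sort) (G : list term) (r : nat -> nat) : Prop :=
  forall n s, nth_error V n = Some s -> lookup G (r n) (trs s).

Lemma wk_ren r t : wk (ren r t) = ren (wkr r) t.
Proof. syntactic. Qed.

Lemma ren_up_wk r t : ren (up_ren r) (wk t) = ren (wkr r) t.
Proof. now rewrite ren_up_ren_wk, wk_ren. Qed.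

Lemma env_wk V G A r : env V G r -> env V (A :: G) (wkr r).
Proof.
  intros HV n s Hn. rewrite <- (ren_tr_sort S s). now apply lookup_wk, HV.
Qed.

Definition rcons (k : nat) (r : nat -> nat) (n : nat) : nat :=
  match n with 0 => k | S n => r n end.

Lemma env_cons V G r k s :
  env V G r -> lookup G k (trs s) -> env (s :: V) G (rcons k r).
Proof. intros HV Hk [|n] s' Hn; [now injection Hn as <- | now apply HV]. Qed.

Lemma env_up V G r s : env V G r -> env (s :: V) (trs s :: G) (up_ren r).
Proof.
  intros HV [|n] s' Hn.
  - injection Hn as <-. rewrite <- (ren_tr_sort S s) at 2. apply lookup_here.
  - exact (env_wk _ _ _ _ HV n s' Hn).
Qed.

Lemma ty_tr_sort G s : ctx G -> G |- trs s # U 0.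
Proof. intros HG. destruct s; ty. Qed.

Lemma ctx_tr_sort G s : ctx G -> ctx (trs s :: G).
Proof. intros HG. exact (ctx_cons _ _ 0 HG (ty_tr_sort G s HG)). Qed.

Lemma ty_tr_expr V t : forall G r s, has_sort V t s -> ctx G -> env V G r ->
  G |- ren r (tre t) # trs s.
Proof.
  induction t; intros G r s Ht HG HV; simpl in Ht.
  1: now apply ty_lookup, HV.
  1: subst; ty.
  1: destruct Ht; subst; apply ty_Succ; apply (IHt _ _ sNum); auto.
  all: destruct Ht as (-> & H1 & H2).
  all: pose proof (IHt1 G r sNum H1 HG HV) as T1; pose proof (IHt2 G r sNum H2 HG HV) as T2;
    simpl in T1, T2; ty.
  (* In a product, the left factor sits below the two binders of the outer recursion and is typed
     afresh there, at the renaming shifted twice. *)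
  assert (HNN : ctx (N :: N :: G)) by ty.
  replace (ren _ _) with (ren (wkr (wkr r)) (tre t1)) by syntactic.
  apply (IHt1 _ _ sNum H1 HNN). now apply env_wk, env_wk.
Qed.

Lemma ty_tr_form p : forall V G r, wf_form V p -> ctx G -> env V G r ->
  G |- ren r (trf p) # U 0.
Proof.
  induction p; intros V G r Hp HG HV; simpl in Hp.
  - destruct Hp as [H1 H2]. apply ty_Id; [ty | | ];
      eapply (ty_tr_expr V _ _ _ sNum); eauto.
  - destruct Hp as [H1 H2].
    apply (ty_tr_expr _ _ G r) in H1, H2; auto.
    apply ty_Id; ty. apply (ty_App_Arrow G N N _ _ 0); ty.
  - ty.
  - destruct Hp as [H1 H2]. pose proof (IHp1 _ _ _ H1 HG HV).
    apply ty_Pi; auto. rewrite ren_up_wk.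
    apply (IHp2 V); auto; [eapply ctx_cons; eauto | now apply env_wk].
  - destruct Hp as [H1 H2]. pose proof (IHp1 _ _ _ H1 HG HV).
    apply ty_Sigma; auto. rewrite ren_up_wk.
    apply (IHp2 V); auto; [eapply ctx_cons; eauto | now apply env_wk].
  - destruct Hp as [H1 H2]. apply ty_Sum; eauto.
  - cbn -[tr_sort]. rewrite ren_tr_sort. apply ty_Pi; [now apply ty_tr_sort|].
    apply (IHp (s :: V)); auto using ctx_tr_sort, env_up.
  - cbn -[tr_sort]. rewrite ren_tr_sort. apply ty_Sigma; [now apply ty_tr_sort|].
    apply (IHp (s :: V)); auto using ctx_tr_sort, env_up.
Qed.

(** * Well-formedness of derivable formulas *)

Lemma has_sort_esubst V W f t s :
  (forall n s, nth_error V n = Some s -> has_sort W (f n) s) ->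
  has_sort V t s -> has_sort W (esubst f t) s.
Proof. intros Hf. revert s. induction t; simpl; intuition. Qed.

Lemma wf_fsubst p : forall V W f,
  (forall n s, nth_error V n = Some s -> has_sort W (f n) s) ->
  wf_form V p -> wf_form W (fsubst f p).
Proof.
  assert (Up : forall V W f s, (forall n s, nth_error V n = Some s -> has_sort W (f n) s) ->
    forall n s', nth_error (s :: V) n = Some s' -> has_sort (s :: W) (eup f n) s').
  { intros V W f s Hf [|n] s' Hn; [exact Hn|]. simpl.
    apply (has_sort_esubst W); auto. }
  induction p; simpl; intros V W f Hf Hp; intuition eauto using has_sort_esubst.
Qed.

Lemma wf_fwk V s p : wf_form V p -> wf_form (s :: V) (fwk p).
Proof. apply wf_fsubst. auto. Qed.

Lemma wf_finst V s p t : wf_form (s :: V) p -> has_sort V t s -> wf_form V (finst p t).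
Proof.
  intros Hp Ht. revert Hp. apply wf_fsubst.
  intros [|n] s' Hn; [now injection Hn as <- | exact Hn].
Qed.

Lemma PA2_axiom_wf V p : PA2_axiom V p -> wf_form V p.
Proof.
  intros [ | | | | | | | q Hq]; simpl; intuition;
    revert Hq; apply wf_fsubst; intros [|n]; auto.
Qed.

(** Elimination rules have premises with formulas absent from the conclusion, such as the antecedent
    in [pa_imp_e]. Their well-formedness, and with it the typing of their translations, is recovered
    from the derivation. *)
Lemma PA2_wf V H p : PA2 V H p -> (forall h, In h H -> wf_form V h) -> wf_form V p.
Proof.
  assert (C : forall V H q, wf_form V q -> (forall h, In h H -> wf_form V h) ->
    forall h, In h (q :: H) -> wf_form V h)
    by (intros V0 H0 q Hq HH h [<- | Hh]; auto).
  assert (M : forall V s H, (forall h, In h H -> wf_form V h) ->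
    forall h, In h (map fwk H) -> wf_form (s :: V) h)
    by (intros V0 s H0 HH h Hh; apply in_map_iff in Hh as (h' & <- & Hh); auto using wf_fwk).
  induction 1; intros HH; simpl in *; try (intuition; fail); eauto using PA2_axiom_wf, wf_finst.
  - destruct (IHPA2_1 HH). eauto.
  - apply (wf_finst _ sNum); auto. apply (IHPA2_1 HH).
Qed.

(** * Comprehension *)

(* [When c (Succ Zero) Zero] is the characteristic function of [c : A + (A -> N0)]. *)
Definition holds (c : term) : term := Id N (When c (Succ Zero) Zero) (Succ Zero).

Section Decision.
Context (V : list sort) (p : form) (Hp : wf_form V p).

Local Notation P r := (ren r (trf p)).

Lemma ty_P G r : ctx G -> env V G r -> G |- P r # U 0.
Proof. intros HG HV. apply (ty_tr_form p V); assumption. Qed.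

Lemma ty_NegP G r : ctx G -> env V G r -> G |- Neg (P r) # U 0.
Proof. intros HG HV. apply ty_Neg; [|apply ty_P]; assumption. Qed.

Lemma ty_holds G r c : ctx G -> env V G r -> G |- c # Sum (P r) (Neg (P r)) ->
  G |- holds c # U 0.
Proof.
  intros HG HV Hc. unfold holds. ty.
  apply (ty_When_N _ (P r) (Neg (P r))); auto using ty_P, ty_NegP.
Qed.

Lemma ty_Inl_P G r a : ctx G -> env V G r -> G |- a # P r ->
  G |- Inl a # Sum (P r) (Neg (P r)).
Proof. intros HG HV Ha. apply (ty_Inl _ _ _ _ 0); auto using ty_NegP. Qed.

Lemma ty_Inr_P G r b : ctx G -> env V G r -> G |- b # Neg (P r) ->
  G |- Inr b # Sum (P r) (Neg (P r)).
Proof. intros HG HV Ha. apply (ty_Inr _ _ _ _ 0); auto using ty_P. Qed.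

Lemma ty_Lem_P G r : ctx G -> env V G r -> G |- Lem (P r) # Sum (P r) (Neg (P r)).
Proof. intros HG HV. apply (ty_lem _ _ 0); auto using ty_P. Qed.

Lemma te_holds_Inl G r a : ctx G -> env V G r -> G |- a # P r ->
  G |- When (Inl a) (Succ Zero) Zero == Succ Zero # N.
Proof.
  intros HG HV Ha. apply (te_When_N_Inl _ (P r) (Neg (P r))); auto using ty_P, ty_NegP.
Qed.

Lemma te_holds_Inr G r b : ctx G -> env V G r -> G |- b # Neg (P r) ->
  G |- When (Inr b) (Succ Zero) Zero == Zero # N.
Proof.
  intros HG HV Ha. apply (te_When_N_Inr _ (P r) (Neg (P r))); auto using ty_P, ty_NegP.
Qed.

Hint Resolve ty_P ty_NegP ty_holds ty_Inl_P ty_Inr_P ty_Lem_P env_wk ctx_cons0 : dec.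

Ltac syn := unfold holds; syntactic.

(** For a decision [Inl a] the element [a] is the answer; for [Inr b] the assumption computes to an
    identity between 0 and 1, which is absurd. *)
Lemma dec_sound G r z : ctx G -> env V G r -> G |- z # holds (Lem (P r)) ->
  exists a, G |- a # P r.
Proof.
  intros HG HV Hz.
  assert (HA : ctx (P r :: G)) by eauto with dec.
  assert (HB : ctx (Neg (P r) :: G)) by eauto with dec.
  assert (HS : ctx (Sum (P r) (Neg (P r)) :: G)) by (ty; eauto with dec).
  assert (V0 : P r :: G |- Var 0 # P (wkr r)) by (apply ty_Var0; [exact HA | apply wk_ren]).
  (* The assumption belongs to the motive: its type must change with the decision in each branch. *)
  set (C := Arrow (holds (Var 0)) (wk (P r))).
  assert (HC : Sum (P r) (Neg (P r)) :: G |- C # U 0).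
  { apply ty_Arrow.
    - apply (ty_holds _ (wkr r)); eauto with dec.
      apply ty_Var0; [exact HS | syn].
    - rewrite (wk_ren r), wk_ren. apply ty_P; eauto with dec.
      apply ctx_cons0; auto. apply (ty_holds _ (wkr r)); eauto with dec.
      apply ty_Var0; [exact HS | syn]. }
  assert (Hl : P r :: G |- holds (Inl (Var 0)) # U 0).
  { apply (ty_holds _ (wkr r)); eauto with dec. }
  assert (Hb : Neg (P r) :: G |- Var 0 # Neg (P (wkr r))) by (apply ty_Var0; [exact HB | syn]).
  assert (Hr : Neg (P r) :: G |- holds (Inr (Var 0)) # U 0).
  { apply (ty_holds _ (wkr r)); eauto with dec. }
  assert (HrG := ctx_cons _ _ 0 HB Hr).
  assert (He : exists e, holds (Inr (Var 0)) :: Neg (P r) :: G |- e # P (wkr (wkr r))).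
  { apply (Zero_eq_Succ_elim _ Zero (Var 0)).
    - exact HrG.
    - ty.
    - apply (Id_conv _ (When (Inr (Var 1)) (Succ Zero) Zero) _ (Succ Zero)); auto.
      + apply (te_holds_Inr _ (wkr (wkr r))); eauto with dec.
        apply ty_Var1; [exact HrG | syn].
      + apply te_refl; ty.
      + now apply ty_Var0.
    - rewrite wk_ren. apply ty_P; ty. eauto with dec. }
  destruct He as [e He].
  assert (Hf : G |- When (Lem (P r)) (Lam (Var 1)) (Lam e) # Arrow (holds (Lem (P r))) (P r)).
  { eapply ty_eq; [apply (ty_When G (P r) (Neg (P r)) C _ _ _ 0 0)|].
    - eauto with dec.
    - eauto with dec.
    - exact HC.
    - eauto with dec.
    - apply (ty_Lam _ (holds (Inl (Var 0))) _ (Var 1) 0); [exact Hl|].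
      apply ty_Var1; eauto with dec. syn.
    - apply (ty_Lam _ (holds (Inr (Var 0))) _ _ 0); [exact Hr|].
      eapply ty_eq; [exact He | syn].
    - unfold C. syn. }
  eexists. eapply (ty_App_Arrow G); [| | exact Hf | exact Hz].
  - eauto with dec.
  - rewrite wk_ren. apply ty_P; eauto with dec.
Qed.

(** For [Inl] the claim computes to an identity between 1 and 1; for [Inr] the refutation is applied
    to the element of the proposition. *)
Lemma dec_complete G r a : ctx G -> env V G r -> G |- a # ren r (trf p) ->
  exists b, G |- b # holds (Lem (P r)).
Proof.
  intros HG HV Ha.
  assert (HA : ctx (P r :: G)) by eauto with dec.
  assert (HB : ctx (Neg (P r) :: G)) by eauto with dec.
  assert (HS : ctx (Sum (P r) (Neg (P r)) :: G)) by (ty; eauto with dec).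
  assert (HPX : forall X, ctx (X :: G) -> ctx (wk (P r) :: X :: G))
    by (intros X HX; rewrite wk_ren; eauto with dec).
  (* [a] is typed in [G] only, so the branches bind their own element of the proposition and [a] is
     supplied as the final argument. *)
  set (C := Arrow (wk (P r)) (holds (Var 0))).
  assert (HC : Sum (P r) (Neg (P r)) :: G |- C # U 0).
  { apply ty_Arrow.
    - rewrite wk_ren. eauto with dec.
    - apply (ty_holds _ (wkr (wkr r))); eauto with dec.
      apply ty_Var1; [auto | syn]. }
  assert (Hd : wk (P r) :: P r :: G |- Refl (When (Inl (Var 1)) (Succ Zero) Zero)
    # holds (Inl (Var 1))).
  { assert (Hv : wk (P r) :: P r :: G |- Var 1 # P (wkr (wkr r)))
      by (apply ty_Var1; [auto | syn]).
    apply Id_of_conv; auto.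
    - apply (ty_When_N _ (P (wkr (wkr r))) (Neg (P (wkr (wkr r))))); auto with dec.
    - apply (te_holds_Inl _ (wkr (wkr r))); auto with dec. }
  assert (He : wk (P r) :: Neg (P r) :: G |- R0 (App (Var 1) (Var 0)) # holds (Inr (Var 1))).
  { apply (ty_R0_const _ _ _ 0).
    - assert (HN : ctx (N0 :: wk (P r) :: Neg (P r) :: G))
        by (apply ctx_cons0; [|apply ty_N0]; auto).
      apply (ty_holds _ (wkr (wkr (wkr r)))); [exact HN | auto with dec |].
      apply ty_Inr_P; auto with dec.
      apply ty_lookup; [exact HN|]. eexists; split; [reflexivity | syn].
    - apply (ty_App_Arrow _ (P (wkr (wkr r))) N0 (Var 1) (Var 0) 0).
      + auto with dec.
      + apply ty_N0. auto with dec.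
      + apply ty_Var1; [auto | syn].
      + apply ty_Var0; [auto | syn]. }
  assert (Hf : G |- When (Lem (P r)) (Lam (Refl (When (Inl (Var 1)) (Succ Zero) Zero)))
    (Lam (R0 (App (Var 1) (Var 0)))) # Arrow (P r) (holds (Lem (P r)))).
  { eapply ty_eq; [apply (ty_When G (P r) (Neg (P r)) C _ _ _ 0 0)|].
    - eauto with dec.
    - eauto with dec.
    - exact HC.
    - eauto with dec.
    - eapply ty_eq; [apply (ty_Lam _ (wk (P r)) (holds (Inl (Var 1))) _ 0); [|exact Hd]|].
      + rewrite wk_ren. auto with dec.
      + unfold C. syn.
    - eapply ty_eq; [apply (ty_Lam _ (wk (P r)) (holds (Inr (Var 1))) _ 0); [|exact He]|].
      + rewrite wk_ren. auto with dec.
      + unfold C. syn.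
    - unfold C. syn. }
  eexists. eapply (ty_App_Arrow G); [| | exact Hf | exact Ha].
  - eauto with dec.
  - change (P r :: G |- holds (Lem (wk (P r))) # U 0). rewrite wk_ren. eauto with dec.
Qed.

End Decision.

Lemma comprehension_valid V p G r : wf_form (sNum :: V) p -> ctx G -> env V G r ->
  exists a, G |- a # ren r (trf (fEx sSet (fAll sNum
    (fIff (fMem (eVar 0) (eVar 1)) (fren (up_ren S) p))))).
Proof.
  intros Hp HG HV.
  set (W := fun r => When (Lem (ren r (trf p))) (Succ Zero) Zero).
  assert (HW : forall D r', ctx D -> env (sNum :: V) D r' -> D |- W r' # N).
  { intros D r' HD HV'.
    apply (ty_When_N _ (ren r' (trf p)) (Neg (ren r' (trf p))));
      eauto using ty_P, ty_NegP, ty_Lem_P. }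
  (* The point is a variable [k], so the beta-reduct is the same decision under the renaming
     [rcons k r'] and the decision lemmas apply to it directly. *)
  assert (Hbeta : forall D r' k, ctx D -> env V D r' -> lookup D k N ->
    D |- App (Lam (W (up_ren r'))) (Var k) == W (rcons k r') # N).
  { intros D r' k HD HV' Hk.
    replace (W (rcons k r')) with (inst (W (up_ren r')) (Var k)) by (unfold W; syntactic).
    apply (te_beta D N N _ _ 0); [ty | | now apply ty_lookup].
    apply HW; [ty | now apply (env_up V D r' sNum)]. }
  set (M := fun r k => Id N (App (Lam (W (up_ren r))) (Var k)) (Succ Zero)).
  set (Q := fun r k => ren (rcons k r) (trf p)).
  (* [M] and [Q] are the two sides of the equivalence at the point [k]; [ok] bundles what makes them
     types and is stable under context extension. *)
  set (ok := fun D r k => ctx D /\ env V D r /\ lookup D k N).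
  assert (wkM : forall r k, wk (M r k) = M (wkr r) (S k)) by (intros; unfold M, W; syntactic).
  assert (wkQ : forall r k, wk (Q r k) = Q (wkr r) (S k)) by (intros; unfold Q; syntactic).
  assert (okS : forall D r k A, ok D r k -> D |- A # U 0 -> ok (A :: D) (wkr r) (S k)).
  { intros D r' k A (HD & HV' & Hk) HA. repeat split.
    - eapply ctx_cons; eauto.
    - now apply env_wk.
    - now apply (lookup_wk _ _ _ N). }
  assert (HM : forall D r k, ok D r k -> D |- M r k # U 0).
  { intros D r' k (HD & HV' & Hk). unfold M. ty.
    apply (ty_App_Arrow _ N N _ _ 0); [ty | ty | | now apply ty_lookup].
    apply (ty_Lam _ _ _ _ 0); [ty | apply HW; [ty | now apply (env_up V D r' sNum)]]. }
  assert (HQ : forall D r k, ok D r k -> D |- Q r k # U 0).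
  { intros D r' k (HD & HV' & Hk). apply (ty_tr_form p (sNum :: V)); auto using env_cons. }
  assert (HMQ : forall D r k, ok D r k -> exists a, D |- a # Arrow (M r k) (Q r k)).
  { intros D r' k Hok. apply (ex_Lam _ _ _ 0); [apply Hok | auto | intros HC].
    rewrite wkQ. pose proof (okS _ _ _ _ Hok (HM _ _ _ Hok)) as (HD & HV' & Hk).
    apply (dec_sound (sNum :: V) p Hp _ _ (Var 0)); auto using env_cons.
    eapply Id_conv; [now apply Hbeta | apply te_refl; ty | auto |].
    apply ty_lookup; auto. change (Id _ _ _) with (M (wkr r') (S k)).
    rewrite <- wkM. apply lookup_here. }
  assert (HQM : forall D r k, ok D r k -> exists a, D |- a # Arrow (Q r k) (M r k)).
  { intros D r' k Hok. apply (ex_Lam _ _ _ 0); [apply Hok | auto | intros HC].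
    rewrite wkM. pose proof (okS _ _ _ _ Hok (HQ _ _ _ Hok)) as (HD & HV' & Hk).
    destruct (dec_complete (sNum :: V) p Hp _ (rcons (S k) (wkr r')) (Var 0) HD) as [b Hb];
      auto using env_cons.
    - apply ty_lookup; auto. change (ren _ _) with (Q (wkr r') (S k)).
      rewrite <- wkQ. apply lookup_here.
    - exists b. eapply Id_conv; [now apply te_sym, Hbeta | apply te_refl; ty | auto | exact Hb]. }
  set (q := fAll sNum (fIff (fMem (eVar 0) (eVar 1)) (fren (up_ren S) p))).
  assert (Wq : wf_form (sSet :: V) q) by exact (PA2_axiom_wf _ _ (ax_comprehension _ _ Hp)).
  assert (HS := ctx_tr_sort G sSet HG).
  apply (ex_Pair G (trs sSet) (ren (up_ren r) (trf q)) (Lam (W (up_ren r))) 0).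
  - now apply ty_tr_sort.
  - apply (ty_tr_form q (sSet :: V)); auto using env_up.
  - apply (ty_Lam _ _ _ _ 0); [ty | apply HW; [ty | now apply (env_up V G r sNum)]].
  (* The renaming [up_ren S] keeps the set variable out of [p], so the substituted witness reaches
     only the membership atoms. *)
  - replace (inst _ _) with (Pi N (Prod (Arrow (M (wkr r) 0) (Q (wkr r) 0))
      (Arrow (Q (wkr r) 0) (M (wkr r) 0)))).
    2: { unfold q, fren. cbn -[fsubst fun_sets]. rewrite !tr_form_fsubst.
      unfold M, Q, W. syntactic. }
    apply (ex_Lam _ _ _ 0); [ty | ty | intros HN].
    assert (ok0 : ok (N :: G) (wkr r) 0).
    { repeat split; [ty | now apply env_wk | apply (lookup_here G N)]. }
    destruct (HMQ _ _ _ ok0) as [a Ha]. destruct (HQM _ _ _ ok0) as [b Hb].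
    assert (HA : N :: G |- Arrow (M (wkr r) 0) (Q (wkr r) 0) # U 0).
    { apply ty_Arrow; auto. rewrite wkQ. auto. }
    apply (ex_Pair _ _ _ a 0); auto.
    + change (wk (Arrow ?x ?y)) with (Pi (wk x) (ren (up_ren S) (wk y))).
      rewrite ren_up_ren_wk, wkM, wkQ. apply ty_Arrow; auto. rewrite wkM. auto.
    + exists b. eapply ty_eq; [exact Hb | unfold M, Q, W; syntactic].
Qed.

(** * Soundness *)

(* Hypotheses are required to be variables of [G], not merely inhabited, because
   variables survive context extension without a weakening theorem for typing. *)
Definition valid (V : list sort) (H : list form) (p : form) : Prop :=
  forall G r, ctx G -> env V G r ->
    (forall h, In h H -> exists n, lookup G n (ren r (trf h))) ->
    exists a, G |- a # ren r (trf p).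

Lemma axiom_valid V H p : PA2_axiom V p -> valid V H p.
Proof.
  intros [ | | | | | | | q Hq] G r HG HV _; [ | | | | | | |now apply (comprehension_valid V)];
    cbn.
  - apply (ex_Lam _ _ _ 0); [ty|ty|intros ?]. apply (ex_Lam _ _ _ 0); [ty|ty|intros ?].
    exists (App (J (Lam (Var 0)) (Var 0)) Star). apply (Succ_neq_Zero _ (Var 1)); ty.
  - do 3 (apply (ex_Lam _ _ _ 0); [ty|ty|intros ?]).
    eexists. apply Succ_inj with (p := Var 0); ty.
  - apply (ex_Lam _ _ _ 0); [ty|ty|intros ?].
    eexists. apply Id_of_conv; ty. apply te_Natrec_N_Zero; ty.
  - do 2 (apply (ex_Lam _ _ _ 0); [ty|ty|intros ?]).
    eexists. apply Id_of_conv; ty. apply te_Natrec_N_Succ; ty.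
  - apply (ex_Lam _ _ _ 0); [ty|ty|intros ?].
    eexists. apply Id_of_conv; ty. apply te_Natrec_N_Zero; ty.
  - do 2 (apply (ex_Lam _ _ _ 0); [ty|ty|intros ?]).
    eexists. apply Id_of_conv; ty.
    (* One computation step yields the required sum, because the step of [times_term] is literally
       [plus_term] at the recursive value and the left factor. *)
    eapply te_trans; [apply te_Natrec_N_Succ; ty | apply te_refl; ty].
  (* [T] is the antecedent of the induction axiom over the set variable; [A] and [B] are its
     components, with indices shifted to the context where the pair is split. *)
  - set (T := Sigma (Id N (App (Var 0) Zero) (Succ Zero))
       (Pi N (Pi (Id N (App (Var 2) (Var 0)) (Succ Zero))
                 (Id N (App (Var 3) (Succ (Var 1))) (Succ Zero))))).
    set (A := Id N (App (Var 2) Zero) (Succ Zero)).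
    set (B := Pi N (Pi (Id N (App (Var 4) (Var 0)) (Succ Zero))
                 (Id N (App (Var 5) (Succ (Var 1))) (Succ Zero)))).
    apply (ex_Lam _ _ _ 0); [ty|ty|intros ?].
    apply (ex_Lam _ _ _ 0); [ty| |intros ?].
    { assert (ctx (N :: Pi N N :: G)) by ty.
      unfold T. ty. }
    apply (ex_Lam _ _ _ 0); [ty|ty|intros H3].
    assert (HA : N :: T :: Pi N N :: G |- A # U 0) by (unfold A; ty).
    assert (HGA := ctx_cons _ _ 0 H3 HA).
    assert (HB : A :: N :: T :: Pi N N :: G |- B # U 0) by (unfold B; ty).
    assert (HGB := ctx_cons _ _ 0 HGA HB).
    assert (HS := ctx_cons _ _ 0 H3 (ty_Sigma _ _ _ _ HA HB)).
    apply (ex_Split _ A B _ (Var 1) 0); auto; [ty | ty |].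
    (* Recursion on the given number [Var 2] from the base case [Var 1]. In the step, [Var 2] is the
       closure hypothesis, [Var 1] the predecessor and [Var 0] the recursive proof. *)
    exists (Natrec (Var 1) (App (App (Var 2) (Var 1)) (Var 0)) (Var 2)).
    set (D := B :: A :: N :: T :: Pi N N :: G) in *.
    set (C := Id N (App (Var 5) (Var 0)) (Succ Zero)).
    assert (HN : ctx (N :: D)) by ty.
    assert (HC : N :: D |- C # U 0) by (unfold C, D; ty).
    assert (HNC : ctx (C :: N :: D)) by (eapply ctx_cons; eauto).
    apply (ty_Natrec _ C (Var 1) (App (App (Var 2) (Var 1)) (Var 0)) (Var 2) 0); auto.
    1,3: unfold D; ty.
    assert (HNN : ctx (N :: C :: N :: D)) by ty.
    apply (ty_App _ (Id N (App (Var 6) (Var 1)) (Succ Zero))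
       (Id N (App (Var 7) (Succ (Var 2))) (Succ Zero)) _ _ 0); unfold D in *.
    1,2,4: ty.
    apply (ty_App _ N (Pi (Id N (App (Var 7) (Var 0)) (Succ Zero))
       (Id N (App (Var 8) (Succ (Var 1))) (Succ Zero))) (Var 2) (Var 1) 0).
    all: ty.
Qed.

Lemma hyps_wk G r H A :
  (forall h, In h H -> exists n, lookup G n (ren r (trf h))) ->
  forall h, In h H -> exists n, lookup (A :: G) n (ren (wkr r) (trf h)).
Proof.
  intros HH h Hh. destruct (HH h Hh) as [n Hn]. exists (S n).
  rewrite <- wk_ren. now apply lookup_wk.
Qed.

Lemma hyps_cons G r H p :
  (forall h, In h H -> exists n, lookup G n (ren r (trf h))) ->
  forall h, In h (p :: H) ->
    exists n, lookup (ren r (trf p) :: G) n (ren (wkr r) (trf h)).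
Proof.
  intros HH h [<- | Hh]; [|now apply hyps_wk with H].
  exists 0. rewrite <- wk_ren. apply lookup_here.
Qed.

Lemma hyps_up G r H s :
  (forall h, In h H -> exists n, lookup G n (ren r (trf h))) ->
  forall h, In h (map fwk H) ->
    exists n, lookup (trs s :: G) n (ren (up_ren r) (trf h)).
Proof.
  intros HH h Hh. apply in_map_iff in Hh as (h' & <- & Hh).
  rewrite tr_form_fwk, ren_up_wk. now apply hyps_wk with H.
Qed.

Lemma ren_tr_form_finst r p t :
  ren r (trf (finst p t)) = inst (ren (up_ren r) (trf p)) (ren r (tre t)).
Proof. rewrite tr_form_finst. syntactic. Qed.

(* The motive of [J] is [p(x) -> p(y)], which holds on the diagonal by the identity. *)
Lemma eq_subst_valid V p t u G r e a : wf_form (sNum :: V) p ->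
  has_sort V t sNum -> has_sort V u sNum -> ctx G -> env V G r ->
  G |- e # Id N (ren r (tre t)) (ren r (tre u)) ->
  G |- a # ren r (trf (finst p t)) -> exists b, G |- b # ren r (trf (finst p u)).
Proof.
  intros Hp Ht Hu HG HV He Ha.
  set (P := fun r => ren r (trf p)).
  assert (HGJ : ctx (J_ctx N G)) by (unfold J_ctx; ty).
  assert (HVJ : env V (J_ctx N G) (wkr (wkr (wkr r)))) by (unfold J_ctx; auto using env_wk).
  (* In the context of the motive, index 2 is the left end of the identity and index 1 the right
     end; [r2] and [r1] read [p] at these points. *)
  set (r2 := rcons 2 (wkr (wkr (wkr r)))). set (r1 := rcons 1 (wkr (wkr (wkr r)))).
  assert (V2 : env (sNum :: V) (J_ctx N G) r2).
  { apply env_cons; auto. exists N; now split. }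
  assert (V1 : env (sNum :: V) (J_ctx N G) r1).
  { apply env_cons; auto. exists N; now split. }
  assert (HP2 : J_ctx N G |- P r2 # U 0) by (apply (ty_tr_form p (sNum :: V)); auto).
  assert (HP1 : P r2 :: J_ctx N G |- wk (P r1) # U 0).
  { unfold P. rewrite wk_ren. apply (ty_tr_form p (sNum :: V)); auto using env_wk.
    eapply ctx_cons; eauto. }
  assert (HN : ctx (N :: G)) by ty.
  assert (HD : N :: G |- P (up_ren r) # U 0)
    by (apply (ty_tr_form p (sNum :: V)); auto; now apply (env_up V G r sNum)).
  assert (Hf : G |- J (Lam (Var 0)) e #
     Arrow (ren r (trf (finst p t))) (ren r (trf (finst p u)))).
  { rewrite !ren_tr_form_finst.
    eapply ty_eq.
    - apply (ty_J G N (Arrow (P r2) (P r1)) (Lam (Var 0)) (ren r (tre t)) (ren r (tre u)) e 0 0).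
      + ty.
      + now apply ty_Arrow.
      + eapply ty_eq; [apply (ty_Lam _ (P (up_ren r)) (wk (P (up_ren r))) _ 0 HD)|].
        * apply ty_lookup; [eapply ctx_cons; eauto | apply lookup_here].
        * unfold P, r1, r2. syntactic.
      + now apply (ty_tr_expr V t G r sNum).
      + now apply (ty_tr_expr V u G r sNum).
      + exact He.
    - unfold P, r1, r2. syntactic. }
  assert (Wt : wf_form V (finst p t)) by now apply (wf_finst _ sNum).
  assert (Wu : wf_form V (finst p u)) by now apply (wf_finst _ sNum).
  pose proof (ty_tr_form _ _ _ _ Wt HG HV) as Tt.
  eexists. eapply (ty_App_Arrow G _ _ _ _ 0 Tt); [| exact Hf | exact Ha].
  rewrite wk_ren. apply (ty_tr_form _ V); auto using env_wk. eapply ctx_cons; eauto.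
Qed.

(** Each deduction rule becomes the matching introduction or elimination of types. As negation is
    translated to an arrow into [N0], [pa_em] is literally an instance of [Lem]. *)
Lemma soundness V H p : PA2 V H p -> (forall h, In h H -> wf_form V h) -> valid V H p.
Proof.
  assert (Ext : forall V p q G r, wf_form V p -> wf_form V q -> ctx G -> env V G r ->
    G |- ren r (trf p) # U 0 /\ ctx (ren r (trf p) :: G) /\
    ren r (trf p) :: G |- wk (ren r (trf q)) # U 0).
  { intros V0 p0 q G r Hp Hq HG HV. pose proof (ty_tr_form _ _ _ _ Hp HG HV) as HP.
    assert (HC := ctx_cons _ _ 0 HG HP). repeat split; auto.
    rewrite wk_ren. apply (ty_tr_form q V0); auto using env_wk. }
  induction 1; intros WH G v HG HV HH.
  - now apply (axiom_valid V H).
  - destruct (HH p) as [n Hn]; auto. exists (Var n). now apply ty_lookup.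
  - destruct (IHPA2 WH G v HG HV HH) as [a Ha]. exists (R0 a).
    apply (ty_R0_const _ _ _ 0); auto.
    rewrite wk_ren. apply (ty_tr_form p V); auto using env_wk. ty.
  - exists (Lem (ren v (trf p))). apply (ty_lem _ _ 0). now apply (ty_tr_form p V).
  - cbn -[fun_sets]. unfold Arrow. cbn -[fun_sets]. rewrite ren_up_wk.
    assert (HP : G |- ren v (trf p) # U 0) by now apply (ty_tr_form p V).
    apply (ex_Lam _ _ _ 0); auto. intros HC.
    apply IHPA2; auto using env_wk; [|now apply hyps_cons].
    intros h [<- | Hh]; auto.
  - assert (W : wf_form V (fImp p q)) by eauto using PA2_wf. destruct W as [Wp Wq].
    destruct (IHPA2_1 WH G v HG HV HH) as [f Hf].
    destruct (IHPA2_2 WH G v HG HV HH) as [a Ha].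
    destruct (Ext V p q G v) as (HP & HC & HQ); auto.
    exists (App f a). apply (ty_App_Arrow _ (ren v (trf p)) (ren v (trf q)) _ _ 0); auto.
    eapply ty_eq; [exact Hf | syntactic].
  - assert (Wp : wf_form V p) by eauto using PA2_wf.
    assert (Wq : wf_form V q) by eauto using PA2_wf.
    destruct (IHPA2_1 WH G v HG HV HH) as [a Ha].
    destruct (IHPA2_2 WH G v HG HV HH) as [b Hb].
    destruct (Ext V p q G v) as (HP & HC & HQ); auto.
    cbn -[fun_sets]. unfold Prod. cbn -[fun_sets]. rewrite ren_up_ren_wk.
    apply (ex_Pair _ _ _ a 0); auto.
    exists b. eapply ty_eq; [exact Hb | syntactic].
  - assert (W : wf_form V (fAnd p q)) by eauto using PA2_wf. destruct W as [Wp Wq].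
    destruct (IHPA2 WH G v HG HV HH) as [a Ha].
    destruct (Ext V p q G v) as (HP & HC & HQ); auto.
    cbn -[fun_sets] in Ha. unfold Prod in Ha. cbn -[fun_sets] in Ha. rewrite ren_up_ren_wk in Ha.
    assert (HS := ctx_cons _ _ 0 HG (ty_Sigma _ _ _ _ HP HQ)).
    apply (ex_Split _ _ _ _ a 0 HP HQ); auto.
    + rewrite (wk_ren v (trf p)). apply (ty_tr_form _ V); auto using env_wk.
    + exists (Var 1). apply ty_lookup; [eapply ctx_cons; eauto|].
      apply lookup_wk, lookup_here.
  - assert (W : wf_form V (fAnd p q)) by eauto using PA2_wf. destruct W as [Wp Wq].
    destruct (IHPA2 WH G v HG HV HH) as [a Ha].
    destruct (Ext V p q G v) as (HP & HC & HQ); auto.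
    cbn -[fun_sets] in Ha. unfold Prod in Ha. cbn -[fun_sets] in Ha. rewrite ren_up_ren_wk in Ha.
    assert (HS := ctx_cons _ _ 0 HG (ty_Sigma _ _ _ _ HP HQ)).
    apply (ex_Split _ _ _ _ a 0 HP HQ); auto.
    + rewrite (wk_ren v (trf q)) in *. apply (ty_tr_form _ V); auto using env_wk.
    + exists (Var 0). apply ty_lookup; [eapply ctx_cons; eauto|].
      apply lookup_here.
  - destruct (IHPA2 WH G v HG HV HH) as [a Ha]. exists (Inl a).
    apply (ty_Inl _ _ _ _ 0); auto. now apply (ty_tr_form q V).
  - destruct (IHPA2 WH G v HG HV HH) as [a Ha]. exists (Inr a).
    apply (ty_Inr _ _ _ _ 0); auto. now apply (ty_tr_form p V).
  - assert (W : wf_form V (fOr p q)) by eauto using PA2_wf. destruct W as [Wp Wq].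
    assert (WHp : forall h, In h (p :: H) -> wf_form V h) by (intros h [<- | Hh]; auto).
    assert (WHq : forall h, In h (q :: H) -> wf_form V h) by (intros h [<- | Hh]; auto).
    assert (Wr : wf_form V r) by eauto using PA2_wf.
    destruct (IHPA2_1 WH G v HG HV HH) as [c Hc].
    destruct (Ext V p r G v) as (HP & HCp & _); auto.
    destruct (Ext V q r G v) as (HQ & HCq & _); auto.
    assert (HS := ctx_cons _ _ 0 HG (ty_Sum _ _ _ _ HP HQ)).
    apply (ex_When _ _ _ _ c 0 HP HQ); auto; rewrite (wk_ren v (trf r)).
    + apply (ty_tr_form _ V); auto using env_wk.
    + apply IHPA2_2; auto using env_wk. now apply hyps_cons.
    + apply IHPA2_3; auto using env_wk. now apply hyps_cons.
  - cbn -[tr_sort]. rewrite ren_tr_sort.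
    apply (ex_Lam _ _ _ 0); auto using ty_tr_sort. intros HC.
    apply IHPA2; auto using env_up; [|now apply hyps_up].
    intros h Hh. apply in_map_iff in Hh as (h' & <- & Hh). auto using wf_fwk.
  - destruct (IHPA2 WH G v HG HV HH) as [f Hf].
    assert (Wp : wf_form V (fAll s p)) by eauto using PA2_wf.
    cbn -[tr_sort] in Hf. rewrite ren_tr_sort in Hf. rewrite ren_tr_form_finst.
    eexists. eapply (ty_App G (trs s) _ _ _ 0); [| | exact Hf |].
    + now apply ty_tr_sort.
    + apply (ty_tr_form p (s :: V)); auto using ctx_tr_sort, env_up.
    + now apply (ty_tr_expr V).
  - destruct (IHPA2 WH G v HG HV HH) as [a Ha]. rewrite ren_tr_form_finst in Ha.
    cbn -[tr_sort]. rewrite ren_tr_sort.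
    apply (ex_Pair _ _ _ (ren v (tre t)) 0).
    + now apply ty_tr_sort.
    + apply (ty_tr_form p (s :: V)); auto using ctx_tr_sort, env_up.
    + now apply (ty_tr_expr V).
    + now exists a.
  - assert (Wp : wf_form V (fEx s p)) by eauto using PA2_wf.
    destruct (IHPA2_1 WH G v HG HV HH) as [a Ha].
    cbn -[tr_sort] in Ha. rewrite ren_tr_sort in Ha.
    assert (HS : G |- trs s # U 0) by now apply ty_tr_sort.
    assert (HGS := ctx_tr_sort G s HG).
    assert (HP : trs s :: G |- ren (up_ren v) (trf p) # U 0)
      by (apply (ty_tr_form p (s :: V)); auto using env_up).
    assert (HGP := ctx_cons _ _ 0 HGS HP).
    assert (HGX := ctx_cons _ _ 0 HG (ty_Sigma _ _ _ _ HS HP)).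
    apply (ex_Split _ _ _ _ a 0 HS HP); auto.
    + rewrite (wk_ren v (trf q)). apply (ty_tr_form _ V); auto using env_wk.
    (* The body of [Split] lives over the witness and a proof of [p]; there the twice weakened
       conclusion is [fwk q], as in the premise of [pa_ex_e]. *)
    + replace (wk (wk (ren v (trf q)))) with (ren (wkr (up_ren v)) (trf (fwk q)))
        by (rewrite tr_form_fwk; syntactic).
      apply IHPA2_2; auto using env_wk, env_up; [|now apply hyps_cons, hyps_up].
      intros h [<- | Hh]; auto.
      apply in_map_iff in Hh as (h' & <- & Hh). auto using wf_fwk.
  - eexists. apply (ty_Refl _ _ _ 0); [ty|]. now apply (ty_tr_expr V t G v sNum).
  - assert (W : wf_form V (fEq t u)) by eauto using PA2_wf. destruct W as [Wt Wu].
    destruct (IHPA2_1 WH G v HG HV HH) as [e He].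
    destruct (IHPA2_2 WH G v HG HV HH) as [a Ha].
    now apply (eq_subst_valid V p t u G v e a).
Qed.

Theorem corollary5p3 : exists I : interpretation, interprets_PA2 I.
Proof.
  exists fun_sets. constructor; cbn -[tr_form].
  - unfold plus_term; ty; constructor.
  - unfold times_term; ty; constructor.
  - exists 0; ty; constructor.
  - exists 0; ty; constructor.
  - intros V p Hp HD.
    assert (HG : ctx (map trs V)).
    { clear. induction V; simpl; [constructor | now apply ctx_tr_sort]. }
    destruct (soundness _ _ _ HD (fun h Hh => match Hh with end) (map trs V) (fun n => n) HG)
      as [a Ha].
    + intros n s Hn. exists (trs s). split; [now apply map_nth_error | apply ren_tr_sort].
    + intros h [].
    + exists a. eapply ty_eq; [exact Ha | syntactic].
Qed.
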